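(* Let $0\le k\le n-1$ and let $M_0$ be a strictly convex hypersurface embedded in $\mathbb{S}^{n+1}$, contained in the open hemisphere centered at $p$, which is the radial graph (about $p$) of a positive function $\rho_0$ over $\mathbb{S}^n$. Let $M(t)$, $t\in[0,T)$, be a smooth solution, with every $M(t)$ strictly convex, of the flow $$\partial_t X=\Big(c_{n,k}\,\phi'(\rho)-u\,\frac{\sigma_{k+1}(\lambda)}{\sigma_k(\lambda)}\Big)\nu$$ with initial value $M_0$, and write $M(t)$ as the radial graph of $\rho(\cdot,t)$ over $\mathbb{S}^n$. Then for all $(z,t)\in\mathbb{S}^n\times[0,T)$ $$\min_{\mathbb{S}^n}\rho_0\ \le\ \rho(z,t)\ \le\ \max_{\mathbb{S}^n}\rho_0 .$$
   Context: $n\ge1$; $p\in\mathbb{S}^{n+1}$ is a fixed point lying in the interior of the convex body enclosed by $M_0$. Around $p$ the metric of $\mathbb{S}^{n+1}$ in polar coordinates is $d\rho^2+\phi(\rho)^2dz^2$, with $\phi(\rho)=\sin\rho$, $\rho\in[0,\pi/2)$ the distance to $p$, and $dz^2$ the standard metric on $\mathbb{S}^n$; $\phi'=\cos\rho$. A radial graph of $\rho:\mathbb{S}^n\to(0,\pi/2)$ is the set of points with polar coordinates $(\rho(z),z)$. $\nu$ is the outward unit normal, $u=\langle\phi(\rho)\partial_\rho,\nu\rangle$, $\lambda=(\lambda_1,\dots,\lambda_n)$ are the principal curvatures (positive for small geodesic spheres; strictly convex means all $\lambda_i>0$), $\sigma_m$ is the $m$-th elementary symmetric function ($\sigma_0=1$),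 and $c_{n,k}=\frac{n-k}{k+1}$. *)

(* Defs.v *)
From HB Require Import structures.
From mathcomp Require Import all_boot all_order all_algebra.
From mathcomp Require Import all_classical all_reals all_analysis.

Set Implicit Arguments.
Unset Strict Implicit.
Unset Printing Implicit Defensive.

Import Order.TTheory GRing.Theory Num.Theory.
Import numFieldTopology.Exports numFieldNormedType.Exports.

Local Open Scope classical_set_scope.
Local Open Scope ring_scope.

Section Smoothness.
Variables (R : realType) (V W : normedModType R).

Fixpoint class_C (k : nat) (U : set V) (f : V -> W) : Prop :=
  (forall x, U x -> {for x, continuous f}) /\
  match k with
  | 0 => True
  | k'.+1 => forall v : V,
      (forall x, U x -> derivable f x v) /\ class_C k' U (fun x => 'D_v f x)
  end.

(* [A] need not be open: a map is smooth on [A] when it locally extends to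
   C^oo maps on open sets of the ambient space. This covers both embedded
   submanifolds and the closed end of a time interval [0, T). *)
Definition smooth_on (A : set V) (f : V -> W) : Prop :=
  forall a, A a -> exists (U : set V) (F : V -> W),
    [/\ open U, U a, forall k, class_C k U F
      & forall y, A y -> U y -> f y = F y].

End Smoothness.

Section Sphere.
Variable R : realType.

(* The topology of row vectors comes from the sup norm, but all lengths and
   angles below are Euclidean. *)
Definition dot m (x y : 'rV[R]_m) : R := \sum_i x 0 i * y 0 i.

Definition sphere m : set 'rV[R]_m := [set x | dot x x = 1].

Definition tangent m (x v : 'rV[R]_m) : Prop := dot x v = 0.

Definition unitize m (y : 'rV[R]_m) : 'rV[R]_m := (Num.sqrt (dot y y))^-1 *: y.

(* Differential at a point [x] of the unit sphere, in the tangent direction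
   [v], of a map defined on the sphere: the derivative at [s = 0] of [f] along
   the curve [(x + s v) / |x + s v|]. *)
Definition sdiff m d (f : 'rV[R]_m -> 'rV[R]_d) (x v : 'rV[R]_m) : 'rV[R]_d :=
  'D_v (fun y => f (unitize y)) x.

Definition spherically_convex m (K : set 'rV[R]_m) : Prop :=
  forall x y a b, K x -> K y -> 0 <= a -> 0 <= b -> a *: x + b *: y != 0 ->
    K (unitize (a *: x + b *: y)).

Definition sphere_interior m (K : set 'rV[R]_m) : set 'rV[R]_m :=
  [set y | sphere y /\ within (@sphere m) (nbhs y) K].

End Sphere.

Section PolarCoordinates.
Variables (R : realType) (m : nat) (p : 'rV[R]_m).

(* The unit sphere of the tangent space of the sphere at [p]; this is the copy
   of S^n over which polar coordinates about [p] are taken. *)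
Definition directions : set 'rV[R]_m := [set z | sphere z /\ tangent p z].

(* The point with polar coordinates [(r, z)]: the exponential map at [p]
   applied to [r z]. *)
Definition polar (r : R) (z : 'rV[R]_m) : 'rV[R]_m := cos r *: p + sin r *: z.

Definition radius (y : 'rV[R]_m) : R := acos (dot p y).

Definition direction (y : 'rV[R]_m) : 'rV[R]_m :=
  (sin (radius y))^-1 *: (y - cos (radius y) *: p).

(* The coordinate field d/d(rho): the [r]-derivative of [polar]. *)
Definition radial_field (y : 'rV[R]_m) : 'rV[R]_m :=
  - sin (radius y) *: p + cos (radius y) *: direction y.

Definition open_hemisphere : set 'rV[R]_m := [set y | sphere y /\ 0 < dot p y].

Definition radial_graph (rho : 'rV[R]_m -> R) : set 'rV[R]_m :=
  [set polar (rho z) z | z in directions].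

Definition enclosed_body (rho : 'rV[R]_m -> R) : set 'rV[R]_m :=
  [set y | exists z r, [/\ directions z, 0 <= r <= rho z & y = polar r z]].

End PolarCoordinates.

Section Hypersurfaces.
Variables (R : realType) (n : nat).
Implicit Types (f nu : 'rV[R]_n.+1 -> 'rV[R]_n.+2) (lam : 'I_n -> R).

Definition immersed_hypersurface f : Prop :=
  [/\ smooth_on (@sphere R n.+1) f,
      forall x, sphere x -> sphere (f x)
    & forall x v, sphere x -> tangent x v -> sdiff f x v = 0 -> v = 0].

(* By compactness of S^n, an injective immersion of S^n is an embedding. *)
Definition embedded_hypersurface f : Prop :=
  immersed_hypersurface f /\
  (forall x y, sphere x -> sphere y -> f x = f y -> x = y).

(* [cos s *: f x + sin s *: nu x] is the geodesic of the ambient sphere issuing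
   from [f x] with velocity [nu x]; [K] is the body bounded by the image
   of [f]. *)
Definition outward_unit_normal (K : set 'rV[R]_n.+2) f nu : Prop :=
  smooth_on (@sphere R n.+1) nu /\
  forall x, sphere x ->
    [/\ tangent (f x) (nu x), sphere (nu x),
        forall v, tangent x v -> dot (sdiff f x v) (nu x) = 0
      & \forall s \near 0^'+, ~ K (cos s *: f x + sin s *: nu x)].

(* The eigenvalues of the shape operator, listed with multiplicity along an
   orthonormal frame of principal directions. Since [nu] is orthogonal to [f],
   its Euclidean derivative along the hypersurface is tangent to the ambient
   sphere, hence is its covariant derivative there. With this sign, a geodesic
   sphere of radius [r] with outward normal has curvatures [cot r]. *)
Definition principal_curvatures f nu (x : 'rV[R]_n.+1) lam : Prop :=
  exists e : 'I_n -> 'rV[R]_n.+1,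
    [/\ forall i, tangent x (e i),
        forall i j, dot (sdiff f x (e i)) (sdiff f x (e j)) = (i == j)%:R
      & forall i, sdiff nu x (e i) = lam i *: sdiff f x (e i)].

Definition sigma (m : nat) lam : R :=
  \sum_(A : {set 'I_n} | #|A| == m) \prod_(i in A) lam i.

End Hypersurfaces.

Section Flow.
Variables (R : realType) (n : nat).

(* [0, T), where [T] may be [+oo]. *)
Definition times (T : \bar R) : set R := [set t | 0 <= t /\ (t%:E < T)%E].

(* The derivative at [t] relative to [I]; it is one-sided at an endpoint
   of [I]. *)
Definition time_derivative m (I : set R) (g : R -> 'rV[R]_m) (t : R)
    (w : 'rV[R]_m) : Prop :=
  (s - t)^-1 *: (g s - g t) @[s --> within I t^'] --> w.

Definition flow_speed (k : nat) (p y nu : 'rV[R]_n.+2) (lam : 'I_n -> R) : R :=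
  let u := dot (sin (radius p y) *: radial_field p y) nu in
  (n - k)%:R / k.+1%:R * cos (radius p y) - u * (sigma k.+1 lam / sigma k lam).

(* [X ^~ t] parametrizes M(t), which is the radial graph of [rho ^~ t]; [nu]
   and [lam] are the outward normal and the principal curvatures of M(t). *)
Record strictly_convex_flow (k : nat) (p : 'rV[R]_n.+2) (T : \bar R)
    (X nu : 'rV[R]_n.+1 -> R -> 'rV[R]_n.+2) (lam : 'rV[R]_n.+1 -> R -> 'I_n -> R)
    (rho : 'rV[R]_n.+2 -> R -> R) : Prop := {
  flow_smooth :
    smooth_on (@sphere R n.+1 `*` times T) (fun q => X q.1 q.2);
  flow_immersed : forall t, times T t -> immersed_hypersurface (X^~ t);
  flow_radius : forall z t, directions p z -> times T t -> 0 < rho z t < pi / 2;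
  flow_graph : forall t, times T t ->
    X^~ t @` @sphere R n.+1 = radial_graph p (rho^~ t);
  flow_normal : forall t, times T t ->
    outward_unit_normal (enclosed_body p (rho^~ t)) (X^~ t) (nu^~ t);
  flow_curvatures : forall x t, sphere x -> times T t ->
    principal_curvatures (X^~ t) (nu^~ t) x (lam x t);
  flow_strictly_convex : forall x t i, sphere x -> times T t -> 0 < lam x t i;
  flow_equation : forall x t, sphere x -> times T t ->
    time_derivative (times T) (X x) t
      (flow_speed k p (X x t) (nu x t) (lam x t) *: nu x t)
}.

End Flow.

Definition is_minimum (R : realType) (A : set R) (a : R) : Prop :=
  A a /\ lbound A a.

Definition is_maximum (R : realType) (A : set R) (b : R) : Prop :=
  A b /\ ubound A b.

(* Main.v *)
(* The height F = <p, X> equals cos rho, so the claim is that max F does not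
   increase and min F does not decrease in time. At a spatial extremum x of F
   the tangent space of M(t) is orthogonal to p, so p lies in the span of the
   position X and the normal nu; as nu points outwards, nu is the radial field
   and p = cos(rho) X - sin(rho) nu. The second derivative test then bounds all
   the principal curvatures by cot(rho), from above at a maximum of F and from
   below at a minimum. Since (k+1) sigma_(k+1) = sum_i lambda_i sigma_k(lambda|i)
   and sum_i sigma_k(lambda|i) = (n-k) sigma_k, this compares
   sigma_(k+1)/sigma_k with c_(n,k) cot(rho), so the speed, and with it the time
   derivative of F at x, has the right sign. The maximum principle concludes. *)
From HB Require Import structures.
Require Import Defs.
From mathcomp Require Import all_boot all_order all_algebra.
From mathcomp Require Import all_classical all_reals all_analysis.
From mathcomp Require Import ring lra.

Set Implicit Arguments.
Unset Strict Implicit.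
Unset Printing Implicit Defensive.

Import Order.TTheory GRing.Theory Num.Theory.
Import numFieldTopology.Exports numFieldNormedType.Exports.
Local Open Scope classical_set_scope.
Local Open Scope ring_scope.

(** * Directional derivatives along lines, and limits of finite sums *)

Lemma is_derive_scale_dir {R : numFieldType} {V W : normedModType R}
    (f : V -> W) (x v : V) (df : W) (c : R) :
  is_derive x v f df -> is_derive x (c *: v) f (c *: df).
Proof.
have [->|c0] := eqVneq c 0; first by rewrite !scale0r => _; exact: is_derive0.
move=> [fxv fE].
pose p (h : R) := h^-1 *: (f (h *: v + x) - f x).
have pc : p @ 0^' --> df by rewrite -fE; exact: fxv.
have qc : (fun h : R => h^-1 *: (f (h *: (c *: v) + x) - f x)) @ 0^' --> c *: df.
  have -> : (fun h : R => h^-1 *: (f (h *: (c *: v) + x) - f x)) =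
      (fun h => c *: p (h * c)).
    by apply/funext => h; rewrite /p invfM !scalerA mulrCA divff // mulr1.
  apply: cvgZl_tmp; apply: cvg_comp pc => A [/= r r0 rA].
  exists (r / `|c|) => /=; first by rewrite divr_gt0 ?normr_gt0.
  move=> h /=; rewrite !sub0r !normrN ltr_pdivlMr ?normr_gt0 // => hr h0.
  by apply: rA; rewrite /= ?sub0r ?normrN ?normrM ?mulf_neq0.
by split; [apply/cvg_ex; exists (c *: df)|exact: cvg_lim qc].
Qed.

Lemma is_derive_line {R : numFieldType} {V W : normedModType R}
    (f : V -> W) (x v : V) (df : W) (s : R) :
  is_derive (x + s *: v) v f df -> is_derive s 1 (fun h => f (x + h *: v)) df.
Proof.
have E : (fun h : R => h^-1 *: (f (h *: v + (x + s *: v)) - f (x + s *: v))) =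
   (fun h : R => h^-1 *: (f (x + (h *: 1 + s) *: v) - f (x + s *: v))).
  by apply/funext => h; rewrite [h *: 1]mulr1 scalerDl addrCA; congr (_ *: _).
by move=> [fxv fE]; split; [rewrite /derivable /= -E|rewrite -fE /derive /= -E].
Qed.

Lemma cvg_sum {R : numFieldType} {V : normedModType R} {T : Type}
    {F : set_system T} {FF : Filter F} (I : Type) (r : seq I)
    (f : I -> T -> V) (a : I -> V) :
  (forall i, f i @ F --> a i) ->
  (fun x => \sum_(i <- r) f i x) @ F --> \sum_(i <- r) a i.
Proof.
move=> fa; elim: r => [|i r ih].
  by under eq_fun do rewrite big_nil; rewrite big_nil; exact: cvg_cst.
by under eq_fun do rewrite big_cons; rewrite big_cons; apply: cvgD.
Qed.

(** * From continuous partial derivatives to differentiability and the chain rule *)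

Section C1.
Context {R : realType} {m : nat}.
Implicit Types (U : set 'rV[R]_m) (x v : 'rV[R]_m).

Lemma rV_norm_le (h : 'rV[R]_m) (e : R) :
  0 <= e -> (forall j, `|h 0 j| <= e) -> `|h| <= e.
Proof.
move=> e0 he; rewrite /Num.Def.normr/= mx_normrE (bigmax_le _ e0)//= => -[i j] _.
by rewrite ord1.
Qed.

Lemma rV_coord_le (h : 'rV[R]_m) j : `|h 0 j| <= `|h|.
Proof. by rewrite /Num.Def.normr/= mx_normrE (le_bigmax _ _ (0, j)). Qed.

Let trunc (h : 'rV[R]_m) (k : nat) : 'rV[R]_m :=
  \row_j (if (j < k)%N then h 0 j else 0).

(* Moving one coordinate at a time, each increment is controlled by the mean
   value theorem in a coordinate direction. *)
Lemma differentiable_of_continuous_partials U (g : 'rV[R]_m -> R) x :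
  open U -> U x ->
  (forall y i, U y -> derivable g y (delta_mx 0 i)) ->
  (forall i, {for x, continuous (fun y => 'D_(delta_mx 0 i) g y)}) ->
  differentiable g x.
Proof.
move=> oU Ux dg cg.
pose d (h : 'rV[R]_m) : R := \sum_i h 0 i * 'D_(delta_mx 0 i) g x.
have lin_d : linear d.
  move=> a u w; rewrite /d scaler_sumr -big_split /=; apply: eq_bigr => i _.
  by rewrite !mxE mulrDl -mulrA.
pose dM := GRing.isLinear.Build _ _ _ _ _ lin_d.
pose dL : {linear _ -> _} := HB.pack d dM.
have cd : continuous dL.
  move=> y; apply: (@cvg_sum _ R^o _ (nbhs y)) => i.
  have ci : (fun h : 'rV[R]_m => h 0 i) @ y --> y 0 i by exact: coord_continuous.
  exact: cvgM ci (cvg_cst _).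
have key : g \o shift x = cst (g x) + (dL : 'rV[R]_m -> R^o) +o_ (0 : 'rV[R]_m) id.
  apply/eqaddoP => _/posnumP[e].
  (* The [m] coordinate increments each cost at most [e' * |h|], so together at most [e * |h|];
     dividing by [m.+1] also covers [m = 0]. *)
  pose e' : R := e%:num / m.+1%:R.
  have e'0 : 0 < e' by rewrite divr_gt0.
  have /nbhs_ballP[r /= r0 Hr] : \forall y \near x, U y /\
     forall i, `|'D_(delta_mx 0 i) g x - 'D_(delta_mx 0 i) g y| <= e'.
    near=> y; split; first by near: y; exact: open_nbhs_nbhs.
    near: y; apply: filter_forall => i.
    exact: ((cvgrPdist_le _ _).1 (cg i)).
  near=> h => /=.
  have hr : `|h| < r.
    near: h; apply/nbhs_ballP; exists r => // y.
    by rewrite -ball_normE /= sub0r normrN.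
  have step k : (k < m)%N -> forall i : 'I_m, i = k :> nat ->
     `|g (x + trunc h k.+1) - g (x + trunc h k)
        - h 0 i * 'D_(delta_mx 0 i) g x| <= e' * `|h|.
    move=> km i ik.
    pose y0 := x + trunc h k; pose v := h 0 i *: delta_mx 0 i : 'rV[R]_m.
    have trE : trunc h k.+1 = trunc h k + v.
      apply/rowP => j; rewrite !mxE eqxx /= ltnS leq_eqVlt -ik.
      case: (eqVneq j i) => [->|ji]; first by rewrite eqxx ltnn /= add0r mulr1.
      rewrite (_ : (j == i :> nat) = false) /=; last by apply/negbTE.
      by rewrite mulr0 addr0.
    (* In the sup norm the intermediate points stay in the ball, since every coordinate of their
       offset from [x] is at most [|h|] in absolute value. *)
    have close (s : R) : s \in `[0, 1] -> ball x r (y0 + s *: v).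
      rewrite in_itv /= => /andP[s0 s1].
      rewrite -ball_normE /= /y0 -addrA opprD addrA subrr sub0r normrN.
      apply: le_lt_trans hr; apply: rV_norm_le => // j; rewrite !mxE eqxx /=.
      case: (eqVneq j i) => [->|ji].
        rewrite ik ltnn add0r mulr1 normrM (ger0_norm s0).
        by apply: le_trans (rV_coord_le h i); rewrite ler_piMl.
      rewrite !mulr0 addr0; case: ifP => _; last by rewrite normr0.
      exact: rV_coord_le.
    pose phi (s : R) : R := g (y0 + s *: v).
    pose dphi (s : R) : R := h 0 i * 'D_(delta_mx 0 i) g (y0 + s *: v).
    have dline (s : R) : s \in `[0, 1] -> is_derive s 1 phi (dphi s).
      move=> s01; apply: is_derive_line.
      apply: (@is_derive_scale_dir _ _ R^o) => //.
      by apply: derivableP; apply: dg; apply: (Hr _ (close _ s01)).1.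
    have cphi : {within `[0, 1], continuous phi}.
      by apply: derivable_within_continuous => s s01; have [] := dline _ s01.
    have dphiP (s : R) : s \in `]0, 1[ -> is_derive s 1 phi (dphi s).
      by move=> s01; apply: dline; apply: subset_itv_oo_cc.
    have [s s01] := @MVT R phi dphi 0 1 ltr01 dphiP cphi.
    rewrite /phi /dphi scale1r scale0r addr0 subr0 mulr1 /y0 -addrA -trE => ->.
    rewrite -mulrBr normrM mulrC ler_pM // ?rV_coord_le // distrC.
    by apply: (Hr _ (close _ _)).2; apply: subset_itv_oo_cc.
  have tel : g (h + x) - g x - d h = \sum_(i < m)
      (g (x + trunc h i.+1) - g (x + trunc h i) - h 0 i * 'D_(delta_mx 0 i) g x).
    rewrite sumrB; congr (_ - _).
    rewrite -(big_mkord xpredT (fun i => g (x + trunc h i.+1) - g (x + trunc h i))).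
    rewrite telescope_sumr // (_ : trunc h m = h) 1?(_ : trunc h 0 = 0).
    - by rewrite addr0 [h + x]addrC.
    - by apply/rowP => j; rewrite !mxE.
    - by apply/rowP => j; rewrite !mxE ltn_ord.
  rewrite opprD addrA -/d [X in `|X|]tel.
  apply: le_trans (ler_norm_sum _ _ _) _.
  apply: (@le_trans _ _ (\sum_(i < m) e' * `|h|)).
    by apply: ler_sum => i _; apply: step.
  rewrite sumr_const card_ord -mulr_natl mulrA ler_wpM2r // /e'.
  rewrite mulrCA ger_pMr // ler_pdivrMr // mul1r ler_nat //.
apply/diff_locallyP; rewrite (diff_unique cd key); split => //.
Unshelve. all: by end_near. Qed.

End C1.

(** [class_C] speaks only of one fixed direction at a time, whereas the chain rule needs a full
    differential. Splitting [F] into components reduces this to the criterion on partial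
    derivatives. *)
Lemma class_C1_differentiable {R : realType} {m d : nat} (U : set 'rV[R]_m)
    (F : 'rV[R]_m -> 'rV[R]_d) (x : 'rV[R]_m) :
  open U -> U x -> class_C 1 U F -> differentiable F x.
Proof.
move=> oU Ux [_ CF].
have -> : F = \sum_(j < d) (fun y => F y 0 j *: (delta_mx 0 j : 'rV[R]_d)).
  apply/funext => y; rewrite fct_sumE [LHS]matrix_sum_delta big_ord1.
  by apply: eq_bigr.
apply: differentiable_sum => j; apply: differentiableZl.
apply: (differentiable_of_continuous_partials (U := U)) => // [y i Uy|i].
  by have /derivable_mxP := (CF (delta_mx 0 i)).1 _ Uy; apply.
have cD := (CF (delta_mx 0 i)).2.1 _ Ux.
have cj : {for x, continuous (fun y => 'D_(delta_mx 0 i) F y 0 j)}.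
  have ci (z : 'rV[R]_d) : (fun h : 'rV[R]_d => h 0 j) @ z --> z 0 j.
    exact: coord_continuous.
  exact: cvg_comp cD (ci _).
have E : \forall y \near x, 'D_(delta_mx 0 i) F y 0 j =
    'D_(delta_mx 0 i) (fun z => F z 0 j) y.
  near=> y.
  have Uy : U y by near: y; exact: open_nbhs_nbhs.
  by rewrite (derive_mx ((CF (delta_mx 0 i)).1 _ Uy)) mxE.
suff : (fun y => 'D_(delta_mx 0 i) (fun z => F z 0 j) y) @ x -->
    'D_(delta_mx 0 i) (fun z => F z 0 j) x by [].
rewrite -(nbhs_singleton E).
by apply: cvg_trans cj; exact: near_eq_cvg E.
Unshelve. all: by end_near. Qed.

(** Only a directional derivative of [g] is assumed: restricted to the line through [x] along [v],
    [g] becomes a function of one real variable, where derivability and differentiability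
    coincide. *)
Lemma is_derive_chain {R : realType} {V U W : normedModType R}
    (g : V -> U) (F : U -> W) (x v : V) (w : U) :
  is_derive x v g w -> differentiable F (g x) ->
  is_derive x v (F \o g) ('D_w F (g x)).
Proof.
move=> [gxv <-] dF.
have DE (W' : normedModType R) (f : V -> W') :
    'D_v f x = 'D_1 (fun h : R => f (h *: v + x)) 0.
  rewrite /derive; set q1 := (X in lim (X @ _)); set q2 := (X in _ = lim (X @ _)).
  suff -> : q1 = q2 by [].
  by apply/funext => h; rewrite /q1 /q2 /= addr0 scale0r add0r [_%:A]mulr1.
have /derivable1_diffP dphi := (derivable1P g x v).1 gxv.
have dF0 : differentiable F (g ((0 : R) *: v + x)) by rewrite scale0r add0r.
have dc := differentiable_comp dphi dF0.
split; first by apply/derivable1P/derivable1_diffP.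
rewrite DE deriveE // (diff_comp dphi dF0) /= scale0r add0r.
by rewrite deriveE // DE deriveE.
Qed.

(** * The Euclidean inner product: bilinearity, limits and derivatives *)

Section Dot.
Context {R : realType} {m : nat}.
Implicit Types x y z : 'rV[R]_m.

Lemma dotC x y : dot x y = dot y x.
Proof. by apply: eq_bigr => i _; rewrite mulrC. Qed.

Lemma dotDl x y z : dot (x + y) z = dot x z + dot y z.
Proof. by rewrite -big_split; apply: eq_bigr => i _; rewrite mxE mulrDl. Qed.

Lemma dotZl a x y : dot (a *: x) y = a * dot x y.
Proof. by rewrite mulr_sumr; apply: eq_bigr => i _; rewrite mxE mulrA. Qed.

Lemma dotNl x y : dot (- x) y = - dot x y.
Proof. by rewrite -scaleN1r dotZl mulN1r. Qed.

Lemma dotBl x y z : dot (x - y) z = dot x z - dot y z.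
Proof. by rewrite dotDl dotNl. Qed.

Lemma dot0l x : dot 0 x = 0.
Proof. by rewrite -(scale0r 0) dotZl mul0r. Qed.

Lemma dotDr x y z : dot z (x + y) = dot z x + dot z y.
Proof. by rewrite dotC dotDl ![dot _ z]dotC. Qed.

Lemma dotZr a x y : dot x (a *: y) = a * dot x y.
Proof. by rewrite dotC dotZl dotC. Qed.

Lemma dotNr x y : dot x (- y) = - dot x y.
Proof. by rewrite dotC dotNl dotC. Qed.

Lemma dotBr x y z : dot z (x - y) = dot z x - dot z y.
Proof. by rewrite dotDr dotNr. Qed.

Lemma dot_ge0 x : 0 <= dot x x.
Proof. by apply: sumr_ge0 => i _; rewrite -expr2 sqr_ge0. Qed.

Lemma cvg_dot {T : Type} {F : set_system T} {FF : Filter F}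
    (f g : T -> 'rV[R]_m) x y :
  f @ F --> x -> g @ F --> y -> (fun t => dot (f t) (g t)) @ F --> dot x y.
Proof.
move=> fx gy; apply: (@cvg_sum _ R^o) => i.
have ci z : (fun h : 'rV[R]_m => h 0 i) @ z --> z 0 i by exact: coord_continuous.
exact: cvgM (cvg_comp _ _ fx (ci x)) (cvg_comp _ _ gy (ci y)).
Qed.

Lemma is_derive_rowP {V : normedModType R} (f : V -> 'rV[R]_m) (a v : V) df :
  is_derive a v f df <->
  forall i, is_derive a v (fun y : V => f y 0 i) (df 0 i).
Proof.
split=> [[fxv fE] i|fi].
  have fi := (derivable_mxP f a v).1 fxv 0 i.
  by split => //; rewrite -fE derive_mx // mxE.
have fxv : derivable f a v.
  by apply/derivable_mxP => i j; rewrite ord1; case: (fi j).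
split => //; rewrite derive_mx //; apply/rowP => i; rewrite mxE.
by case: (fi i).
Qed.

Lemma is_derive_dot {V : normedModType R} (f g : V -> 'rV[R]_m) (a v : V) df dg :
  is_derive a v f df -> is_derive a v g dg ->
  is_derive a v (fun y : V => dot (f y) (g y)) (dot (f a) dg + dot df (g a)).
Proof.
move=> /is_derive_rowP fi /is_derive_rowP gi.
have -> : (fun y : V => dot (f y) (g y)) =
    \sum_(i < m) ((fun y : V => f y 0 i) * (fun y : V => g y 0 i)).
  by apply/funext => y; rewrite fct_sumE.
apply: is_derive_eq.
rewrite -big_split /=; apply: eq_bigr => i _.
by congr (_ + _); rewrite [RHS]mulrC.
Qed.

End Dot.

(** * Normalization onto the unit sphere and its differential [dunitize] *)

Definition dunitize {R : realType} {m : nat} (y v : 'rV[R]_m) : 'rV[R]_m :=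
  (Num.sqrt (dot y y))^-1 *: (v - dot (unitize y) v *: unitize y).

Section Unitize.
Context {R : realType} {m : nat}.
Implicit Types x y v : 'rV[R]_m.

Lemma unitize_sphere x : sphere x -> unitize x = x.
Proof. by move=> x1; rewrite /unitize x1 sqrtr1 invr1 scale1r. Qed.

Lemma sphere_dot_gt0 x : sphere x -> 0 < dot x x.
Proof. by move=> ->. Qed.

Lemma sphere_unitize y : 0 < dot y y -> sphere (unitize y).
Proof.
move=> y0; rewrite /sphere /= /unitize dotZl dotZr mulrA -expr2 exprVn.
by rewrite sqr_sqrtr ?ltW // mulVf ?gt_eqF.
Qed.

Lemma is_derive_unitize y v : 0 < dot y y ->
  is_derive y v (@unitize R m) (dunitize y v).
Proof.
move=> y0; have s0 : 0 < Num.sqrt (dot y y) by rewrite sqrtr_gt0.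
have dq : is_derive y v (fun z => dot z z) (dot y v *+ 2).
  apply: is_derive_eq; first exact: is_derive_dot.
  by rewrite [dot v y]dotC mulr2n.
have ds : is_derive y v (fun z => Num.sqrt (dot z z)) (dot y v / Num.sqrt (dot y y)).
  have dsq := is_derive1_sqrt y0.
  have dsqd : differentiable (Num.sqrt : R -> R) (dot y y).
    by apply/derivable1_diffP; case: dsq.
  have := is_derive_chain dq dsqd.
  have [_ dE] := is_derive_scale_dir (dot y v *+ 2) dsq.
  rewrite -[X in 'D_X _ _]mulr1 dE => h.
  apply: (@is_derive_eq _ _ R^o _ _ _ _ _ h).
  rewrite -[dot y v *+ 2]mulr_natl.
  change (2 * dot y v * (2 * Num.sqrt (dot y y))^-1 = dot y v / Num.sqrt (dot y y)).
  by field; rewrite gt_eqF.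
have di : is_derive y v (fun z => (Num.sqrt (dot z z))^-1)
    (- (dot y v / Num.sqrt (dot y y) ^+ 3)).
  have [d1 d2] := ds.
  split; first by apply: derivableV => //; rewrite gt_eqF.
  rewrite deriveV ?gt_eqF // d2.
  change (_ *: _) with
    (- (Num.sqrt (dot y y)) ^- 2 * (dot y v / Num.sqrt (dot y y))).
  by field; rewrite gt_eqF.
apply/is_derive_rowP => i.
have -> : (fun z : 'rV[R]_m => unitize z 0 i) =
    (fun z : 'rV[R]_m => (Num.sqrt (dot z z))^-1) * (fun z : 'rV[R]_m => z 0 i).
  by apply/funext => z; rewrite mxE.
have dz : is_derive y v (fun z : 'rV[R]_m => z 0 i) (v 0 i).
  by apply: (is_derive_rowP id y v v).1; exact: is_derive_id.
apply: is_derive_eq; rewrite /dunitize /unitize !mxE dotZl.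
rewrite -[_ *: v 0 i]/(_ * v 0 i) -[y 0 i *: _]/(y 0 i * _).
by field; rewrite gt_eqF.
Qed.

End Unitize.

Section UnitizeLimits.
Context {R : realType} {m : nat}.
Implicit Types x y v : 'rV[R]_m.

Lemma dunitize_tangent y v : 0 < dot y y -> tangent (unitize y) (dunitize y v).
Proof.
move=> y0; rewrite /tangent /dunitize dotZr dotBr dotZr.
have -> : dot (unitize y) (unitize y) = 1 by exact: sphere_unitize.
by rewrite mulr1 subrr mulr0.
Qed.

Lemma dunitize_sphere x v : sphere x -> tangent x v -> dunitize x v = v.
Proof.
move=> x1 xv; rewrite /dunitize (unitize_sphere x1) x1 sqrtr1 invr1 scale1r.
by rewrite xv scale0r subr0.
Qed.

Lemma cvg_unitize {T : Type} {F : set_system T} {FF : Filter F}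
    (g : T -> 'rV[R]_m) y :
  0 < dot y y -> g @ F --> y -> unitize (g t) @[t --> F] --> unitize y.
Proof.
move=> y0 gy; have gg : dot (g t) (g t) @[t --> F] --> dot y y by exact: cvg_dot.
apply: cvgZ => //; apply: cvgV; first by rewrite gt_eqF ?sqrtr_gt0.
by apply: cvg_comp; [exact: gg|exact: sqrt_continuous].
Qed.

Lemma cvg_dunitize {T : Type} {F : set_system T} {FF : Filter F}
    (g : T -> 'rV[R]_m) y v :
  0 < dot y y -> g @ F --> y -> dunitize (g t) v @[t --> F] --> dunitize y v.
Proof.
move=> y0 gy; have gg : dot (g t) (g t) @[t --> F] --> dot y y by exact: cvg_dot.
have uc : unitize (g t) @[t --> F] --> unitize y by exact: cvg_unitize.
apply: cvgZ.
  apply: cvgV; first by rewrite gt_eqF ?sqrtr_gt0.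
  by apply: cvg_comp; [exact: gg|exact: sqrt_continuous].
apply: cvgB; first exact: cvg_cst.
by apply: cvgZ => //; apply: cvg_dot => //; exact: cvg_cst.
Qed.

Lemma dot_line_gt0 x v (s : R) :
  sphere x -> tangent x v -> 0 < dot (x + s *: v) (x + s *: v).
Proof.
move=> x1 xv; rewrite dotDl !dotDr !dotZl !dotZr [dot v x]dotC xv x1.
by rewrite !mulr0 addr0 add0r ltr_pwDl // mulrA -expr2 mulr_ge0 ?sqr_ge0 ?dot_ge0.
Qed.

Lemma near_unitize (U : set 'rV[R]_m) y : 0 < dot y y -> open U ->
  U (unitize y) -> \forall z \near y, 0 < dot z z /\ U (unitize z).
Proof.
move=> y0 oU Uy; near=> z; split; near: z.
  have dc : dot z z @[z --> y] --> dot y y.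
    exact: (@cvg_dot R m _ (nbhs y) _ id id y y (@cvg_id _ _) (@cvg_id _ _)).
  exact: cvgr_gt dc _ y0.
exact: (@cvg_unitize _ (nbhs y) _ id y y0 (@cvg_id _ _)) _
  (open_nbhs_nbhs (conj oU Uy)).
Unshelve. all: by end_near. Qed.

End UnitizeLimits.

(** * Calculus of smooth maps on the sphere *)

Section SphereMaps.
Context {R : realType} {m d : nat}.
Implicit Types (x y v : 'rV[R]_m) (f : 'rV[R]_m -> 'rV[R]_d).

(** Near [y], normalized points lie on the sphere and in [U], so [f] may be replaced there by its
    extension [F], to which the chain rule applies. *)
Lemma is_derive_sphere_ext (U : set 'rV[R]_m) (F : 'rV[R]_m -> 'rV[R]_d) f y v :
  open U -> class_C 1 U F -> (forall z, sphere z -> U z -> f z = F z) ->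
  0 < dot y y -> U (unitize y) ->
  is_derive y v (fun z => f (unitize z)) ('D_(dunitize y v) F (unitize y)).
Proof.
move=> oU CF fF y0 Uy.
have dF := class_C1_differentiable oU Uy CF.
apply: near_eq_is_derive (is_derive_chain (is_derive_unitize v y0) dF).
near=> z; have [z0 Uz] : 0 < dot z z /\ U (unitize z).
  by near: z; exact: near_unitize.
by rewrite /= fF //; exact: sphere_unitize.
Unshelve. all: by end_near. Qed.

Lemma smooth_on_sphereP f x : smooth_on (@sphere R m) f -> sphere x ->
  exists (U : set 'rV[R]_m) (F : 'rV[R]_m -> 'rV[R]_d),
    [/\ open U, U x, class_C 1 U F & forall z, sphere z -> U z -> f z = F z].
Proof.
by move=> sf x1; have [U [F [oU Ux CF fF]]] := sf x x1; exists U, F.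
Qed.

(** This lets curves [x + s *: v] that leave the sphere be used. Since [dunitize] produces a tangent
    vector and fixes tangent vectors at points of the sphere, both sides equal the same derivative
    of a local extension. *)
Lemma is_derive_sdiff f y v : smooth_on (@sphere R m) f -> 0 < dot y y ->
  is_derive y v (fun z => f (unitize z)) (sdiff f (unitize y) (dunitize y v)).
Proof.
move=> sf y0; have u1 := sphere_unitize y0.
have [U [F [oU Uu CF fF]]] := smooth_on_sphereP sf u1.
have ext := is_derive_sphere_ext _ oU CF fF.
suff -> : sdiff f (unitize y) (dunitize y v) = 'D_(dunitize y v) F (unitize y).
  exact: ext.
have Uuu : U (unitize (unitize y)) by rewrite unitize_sphere.
have [_ E] := ext (unitize y) (dunitize y v) (sphere_dot_gt0 u1) Uuu.
have tg := dunitize_tangent v y0.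
by rewrite /sdiff E (unitize_sphere u1) (dunitize_sphere u1 tg).
Qed.

(** The direction [dunitize y v] moves with [y], while [class_C] gives continuity in fixed
    directions only. Expanding it in the standard basis leaves finitely many fixed directions with
    continuous coefficients. *)
Lemma cvg_sphere_derive f x v : smooth_on (@sphere R m) f -> sphere x ->
  'D_v (fun z => f (unitize z)) y @[y --> x] --> 'D_v (fun z => f (unitize z)) x.
Proof.
move=> sf x1; have x0 := sphere_dot_gt0 x1.
have [U [F [oU Ux CF fF]]] := smooth_on_sphereP sf x1.
have Uux : U (unitize x) by rewrite unitize_sphere.
pose G y := \sum_i (dunitize y v) 0 i *: 'D_(delta_mx 0 i) F (unitize y).
have DG : \forall y \near x, 'D_v (fun z => f (unitize z)) y = G y.
  near=> y; have [y0 Uy] : 0 < dot y y /\ U (unitize y).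
    by near: y; exact: near_unitize.
  have [_ ->] := is_derive_sphere_ext v oU CF fF y0 Uy.
  have dF := class_C1_differentiable oU Uy CF.
  rewrite deriveE // [X in 'd _ _ X]matrix_sum_delta big_ord1 linear_sum.
  by apply: eq_bigr => i _; rewrite linearZ /= -deriveE.
rewrite (nbhs_singleton DG).
have GD : \forall y \near x, G y = 'D_v (fun z => f (unitize z)) y.
  by apply: filterS DG => y ->.
apply: cvg_trans (near_eq_cvg GD) _.
apply: (@cvg_sum _ _ _ (nbhs x)) => i; apply: (@cvgZ _ _ _ (nbhs x)).
  have ci (z : 'rV[R]_m) : (fun h : 'rV[R]_m => h 0 i) @ z --> z 0 i.
    exact: coord_continuous.
  exact: cvg_comp (@cvg_dunitize R m _ (nbhs x) _ id x v x0 (@cvg_id _ _)) (ci _).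
have [_ /(_ (delta_mx 0 i))[_ [cD _]]] := CF.
exact: cvg_comp (@cvg_unitize R m _ (nbhs x) _ id x x0 (@cvg_id _ _)) (cD _ Uux).
Unshelve. all: by end_near. Qed.

End SphereMaps.

(** * First and second derivative tests for the height *)

Section CriticalPoints.
Context {R : realType} {m d : nat}.
Implicit Types (x y v e : 'rV[R]_m) (f nu : 'rV[R]_m -> 'rV[R]_d).

(** The derivative of the constant [dot f f = 1] vanishes. *)
Lemma sdiff_dot_self f y v : smooth_on (@sphere R m) f ->
  (forall z, sphere z -> sphere (f z)) -> sphere y -> tangent y v ->
  dot (f y) (sdiff f y v) = 0.
Proof.
move=> sf f1 y1 yv; have y0 := sphere_dot_gt0 y1.
have df := is_derive_sdiff v sf y0.
rewrite dunitize_sphere // (unitize_sphere y1) in df.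
have [_ dd] := is_derive_dot df df.
have : 'D_v (fun z => dot (f (unitize z)) (f (unitize z))) y = 0.
  rewrite (@near_eq_derive _ _ _ _ (cst (1 : R))) ?derive_cst //.
  near=> z; apply: f1; apply: sphere_unitize.
  by near: z; apply: filterS (near_unitize y0 openT I) => z [].
rewrite dd (unitize_sphere y1) [dot (sdiff _ _ _) _]dotC -mulr2n => /eqP.
by rewrite mulrn_eq0 => /eqP.
Unshelve. all: by end_near. Qed.

(** The sign of [eps] selects a maximum or a minimum of the height, so one argument serves both; the
    claim is Fermat's rule along [unitize (x + s *: v)]. *)
Lemma sdiff_critical (p : 'rV[R]_d) (eps : R) f x v :
  smooth_on (@sphere R m) f -> eps != 0 -> sphere x -> tangent x v ->
  (forall y, sphere y -> eps * dot p (f y) <= eps * dot p (f x)) ->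
  dot p (sdiff f x v) = 0.
Proof.
move=> sf eps0 x1 xv xmax.
pose h (s : R) : R := eps * dot p (f (unitize (x + s *: v))).
have dh (s : R) : is_derive s 1 h
    (eps * dot p ('D_v (fun z => f (unitize z)) (x + s *: v))).
  have [df _] := is_derive_sdiff v sf (dot_line_gt0 s x1 xv).
  have dl := is_derive_line (derivableP df).
  have dc : is_derive s 1 (fun=> p) (0 : 'rV[R]_d) by exact: is_derive_cst.
  have dp := is_derive_dot dc dl.
  apply: (@is_derive_eq _ _ R^o _ _ _ _ _ (is_deriveZ eps dp)).
  by rewrite dot0l addr0.
have h0 : is_derive (0 : R) 1 h 0.
  apply: (@derive1_at_max _ h (-1) 1 0);
    rewrite ?in_itv /= ?ltrN10 ?ltr01 ?ltr_pwDl //.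
  move=> s _; rewrite /h scale0r addr0 (unitize_sphere x1); apply: xmax.
  by apply: sphere_unitize; exact: dot_line_gt0.
have [_ d0] := dh 0; have [_ ] := h0; rewrite d0 scale0r addr0 => /eqP.
by rewrite mulf_eq0 (negPf eps0) => /eqP.
Qed.

(* Along the great circle [unitize (x + s e)] the derivative of the height is
   [dot w (f')] with [w = p - a f + b nu]; since [w] vanishes at [x] with
   derivative [(b l - a) f'], this is a second derivative test that uses first
   derivatives of [f] and [nu] only. *)
Lemma curvature_at_extremum (p : 'rV[R]_d) (eps a b l : R) f nu x e :
  smooth_on (@sphere R m) f -> smooth_on (@sphere R m) nu ->
  (forall z, sphere z -> sphere (f z)) ->
  (forall y v, sphere y -> tangent y v -> dot (sdiff f y v) (nu y) = 0) ->
  sphere x -> tangent x e ->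
  p = a *: f x - b *: nu x ->
  dot (sdiff f x e) (sdiff f x e) = 1 ->
  sdiff nu x e = l *: sdiff f x e ->
  (forall y, sphere y -> eps * dot p (f y) <= eps * dot p (f x)) ->
  eps * (b * l) <= eps * a.
Proof.
move=> sf sn f1 fnu x1 xe pE De1 nue xmax.
have x0 s := dot_line_gt0 s x1 xe.
pose phi (s : R) := f (unitize (x + s *: e)).
pose psi (s : R) := nu (unitize (x + s *: e)).
pose D (s : R) : 'rV[R]_d := 'D_e (fun z => f (unitize z)) (x + s *: e).
have D0 : D 0 = sdiff f x e by rewrite /D scale0r addr0.
have dphi (s : R) : is_derive s 1 phi (D s).
  have [df _] := is_derive_sdiff e sf (x0 s).
  exact: is_derive_line (derivableP df).
have dpsi : is_derive (0 : R) 1 psi (l *: D 0).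
  have [dn _] := is_derive_sdiff e sn (x0 0).
  have := is_derive_line (derivableP dn).
  by rewrite scale0r addr0 -/(sdiff nu x e) nue D0.
have DE (s : R) : D s = sdiff f (unitize (x + s *: e)) (dunitize (x + s *: e) e).
  by rewrite /D; have [_ ->] := is_derive_sdiff e sf (x0 s).
have Dphi (s : R) : dot (D s) (phi s) = 0.
  rewrite DE dotC sdiff_dot_self //; first exact: sphere_unitize.
  exact: dunitize_tangent.
have Dpsi (s : R) : dot (D s) (psi s) = 0.
  rewrite DE fnu //; first exact: sphere_unitize.
  exact: dunitize_tangent.
pose w (s : R) : 'rV[R]_d := p - a *: phi s + b *: psi s.
have w0 : w 0 = 0.
  by rewrite /w /phi /psi scale0r addr0 (unitize_sphere x1) pE addrAC subrK subrr.
have dw : is_derive (0 : R) 1 w ((b * l - a) *: D 0).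
  have dp : is_derive (0 : R) 1 (fun=> p) (0 : 'rV[R]_d) by exact: is_derive_cst.
  have := is_deriveD (is_deriveB dp (is_deriveZ a (dphi 0))) (is_deriveZ b dpsi).
  move=> hw; apply: (is_derive_eq (f := w) hw).
  by rewrite sub0r scalerA scalerBl addrC.
pose h (s : R) : R := eps * dot p (phi s).
(* [p] may be replaced by [w s] because [D s] is orthogonal to both [phi s] and [psi s]. *)
have dh (s : R) : is_derive s 1 h (eps * dot (w s) (D s)).
  have dp : is_derive s 1 (fun=> p) (0 : 'rV[R]_d) by exact: is_derive_cst.
  have dd := is_derive_dot dp (dphi s).
  apply: (@is_derive_eq _ _ R^o _ _ _ _ _ (is_deriveZ eps dd)).
  rewrite dot0l addr0 /w dotDl dotBl !dotZl.
  by rewrite ![dot _ (D s)]dotC Dphi Dpsi !mulr0 subr0 addr0.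
have wc : s^-1 *: w s @[s --> 0^'] --> (b * l - a) *: D 0.
  case: dw => dw1 <-; move: dw1; rewrite /derivable /derive.
  have -> : (fun s : R => s^-1 *: ((w \o shift 0) (s *: 1) - w 0)) =
      (fun s : R => s^-1 *: w s).
    by apply/funext => s; rewrite /= w0 subr0 addr0 [_ *: 1]mulr1.
  by [].
have lc : x + s *: e @[s --> (0 : R)] --> x + 0 *: e.
  by apply: cvgD; [exact: cvg_cst|apply: cvgZr_tmp; exact: cvg_id].
rewrite scale0r addr0 in lc.
have Dc0 : D @ (0 : R) --> D 0.
  rewrite D0 /sdiff; exact: (@cvg_comp _ _ _ (fun s : R => x + s *: e)
    ('D_e (fun z => f (unitize z))) _ _ _ lc (cvg_sphere_derive (v := e) sf x1)).
have Dc : D s @[s --> 0^'] --> D 0 by exact: cvg_within_filter Dc0.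
have qc : s^-1 * (eps * dot (w s) (D s)) @[s --> 0^'] --> eps * (b * l - a).
  have wDc : dot (s^-1 *: w s) (D s) @[s --> 0^'] --> b * l - a.
    have -> : b * l - a = dot ((b * l - a) *: D 0) (D 0).
      by rewrite dotZl D0 De1 mulr1.
    exact: cvg_dot.
  have -> : (fun s => s^-1 * (eps * dot (w s) (D s))) =
      (fun s => eps * dot (s^-1 *: w s) (D s)).
    by apply/funext => s; rewrite dotZl mulrCA.
  exact: cvgM (cvg_cst _) wDc.
(* A positive limit of [h'(s) / s] would make [h'] positive on a right neighbourhood of 0; the mean
   value theorem on [[0, r / 2]] then contradicts the maximality of [h 0]. *)
rewrite -subr_ge0 -mulrBr -opprB mulrN oppr_ge0 leNgt; apply/negP => pos.
have /= [r /= r0 Hr] := cvgr_gt _ qc _ pos.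
have r2 : 0 < r / 2 by rewrite divr_gt0.
have ch : {within `[0, r / 2], continuous h}.
  by apply: derivable_within_continuous => s _; have [] := dh s.
have [c /[!in_itv] /= /andP[c0 cr]] :=
  @MVT R h (fun s => eps * dot (w s) (D s)) 0 (r / 2) r2 (fun s _ => dh s) ch.
have hc : 0 < eps * dot (w c) (D c).
  rewrite -(pmulr_rgt0 _ (x := c^-1)) ?invr_gt0 //; apply: Hr; rewrite ?gt_eqF //=.
  rewrite sub0r normrN gtr0_norm // (lt_le_trans cr) // ler_pdivrMr //.
  by rewrite ler_peMr ?ltW // ltr1n.
move=> E; have : 0 < h (r / 2) - h 0 by rewrite E subr0 mulr_gt0.
rewrite subr_gt0 /h /phi scale0r addr0 (unitize_sphere x1) ltNge xmax //.
exact: sphere_unitize.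
Qed.

End CriticalPoints.

(** * Identities and bounds for elementary symmetric functions *)

(** Each set of size [k.+1] is counted once per element [i]; pairs of a set and a chosen element
    correspond to pairs of [i] and a set [B] of size [k] avoiding [i]. *)
Lemma sigma_succ {R : realType} {n : nat} (k : nat) (lam : 'I_n -> R) :
  k.+1%:R * sigma k.+1 lam =
  \sum_i lam i * \sum_(B : {set 'I_n} | (#|B| == k) && (i \notin B))
    \prod_(j in B) lam j.
Proof.
transitivity (\sum_(A : {set 'I_n} | #|A| == k.+1) \sum_(i in A)
    (lam i * \prod_(j in A :\ i) lam j)).
  rewrite /sigma mulr_sumr; apply: eq_bigr => A /eqP Ak.
  rewrite -Ak mulr_natl -sumr_const; apply: eq_bigr => i iA.
  by rewrite [LHS](big_setD1 i).
rewrite (exchange_big_dep xpredT) //=; apply: eq_bigr => i _.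
rewrite -mulr_sumr; congr (_ * _).
rewrite (reindex_onto (fun B => i |: B) (fun A => A :\ i)) /=; last first.
  by move=> A /andP[_ iA]; rewrite finset.setD1K.
apply: eq_big => [B|B /andP[_ /eqP ->] //].
rewrite finset.setU11 andbT cardsU1; have [iB|iB] := boolP (i \in B).
  rewrite andbF; apply/andP => -[_ /eqP E].
  by move: iB; rewrite -E finset.setD11.
by rewrite finset.setU1K // eqxx !andbT add1n eqSS.
Qed.

(** Each set of size [k] is avoided by exactly [n - k] indices. *)
Lemma sigma_complement {R : realType} {n : nat} (k : nat) (lam : 'I_n -> R) :
  \sum_i \sum_(B : {set 'I_n} | (#|B| == k) && (i \notin B))
    \prod_(j in B) lam j = (n - k)%:R * sigma k lam.
Proof.
rewrite (exchange_big_dep (fun B : {set 'I_n} => #|B| == k)) /=; last first.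
  by move=> i B _ /andP[].
rewrite /sigma mulr_sumr; apply: eq_bigr => B Bk.
have E i : (#|B| == k) && (i \notin B) = (i \in ~: B) by rewrite inE Bk.
rewrite (eq_bigl _ _ E) sumr_const cardsCs finset.setCK card_ord (eqP Bk).
by rewrite mulr_natl.
Qed.

Lemma sigma_gt0 {R : realType} {n : nat} (k : nat) (lam : 'I_n -> R) :
  (k <= n)%N -> (forall i, 0 < lam i) -> 0 < sigma k lam.
Proof.
move=> kn lam0.
have prod0 (A : {set 'I_n}) : 0 < \prod_(i in A) lam i by exact: prodr_gt0.
have : (0 < #|[set A : {set 'I_n} | #|A| == k]%SET|)%N.
  by rewrite card_draws card_ord bin_gt0.
move=> /card_gt0P[A]; rewrite inE => Ak.
rewrite /sigma (bigD1 A) //= ltr_pwDl //.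
by apply: sumr_ge0 => B _; exact: ltW.
Qed.

(** In the expansion of [sigma k.+1] the weights of the [lam i] are nonnegative, so each [lam i] may
    be replaced by [c]; the sign of [eps] sets the direction of the bound. *)
Lemma sigma_succ_le {R : realType} {n : nat} (k : nat) (lam : 'I_n -> R)
    (eps c : R) :
  (forall i, 0 < lam i) -> (forall i, eps * lam i <= eps * c) ->
  eps * (k.+1%:R * sigma k.+1 lam) <= eps * (c * ((n - k)%:R * sigma k lam)).
Proof.
move=> lam0 lamc; rewrite sigma_succ -sigma_complement !mulr_sumr.
apply: ler_sum => i _; rewrite !mulrA ler_wpM2r //.
by apply: sumr_ge0 => B _; apply: prodr_ge0 => j _; exact: ltW.
Qed.

(** * Expansion of [p] in the frame adapted to the hypersurface *)

(** The vectors [f], [nu] and the [E i] are the rows of a square matrix [Q] with [Q Q^T = 1], hence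
    also [Q^T Q = 1]: they form an orthonormal basis, in which only two coefficients of [p]
    survive. *)
Lemma orthonormal_decomposition {R : realType} {n : nat}
    (E : 'I_n -> 'rV[R]_n.+2) (f nu p : 'rV[R]_n.+2) :
  (forall i j, dot (E i) (E j) = (i == j)%:R) ->
  dot f f = 1 -> dot nu nu = 1 -> dot f nu = 0 ->
  (forall i, dot f (E i) = 0) -> (forall i, dot (E i) nu = 0) ->
  (forall i, dot p (E i) = 0) ->
  p = dot p f *: f + dot p nu *: nu.
Proof.
move=> EE ff nn fn fE En pE.
pose q (i : 'I_n.+2) : 'rV[R]_n.+2 :=
  if unlift ord0 i is Some j then
    (if unlift ord0 j is Some l then E l else nu) else f.
have q0 : q ord0 = f by rewrite /q unlift_none.
have q1 : q (lift ord0 ord0) = nu by rewrite /q liftK unlift_none.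
have q2 i : q (lift ord0 (lift ord0 i)) = E i by rewrite /q !liftK.
pose Q : 'M[R]_n.+2 := \matrix_i q i.
have QQ : Q *m Q^T = 1%:M.
  apply/matrixP => i j; rewrite !mxE.
  transitivity (dot (q i) (q j)); first by apply: eq_bigr => l _; rewrite !mxE.
  case: (unliftP ord0 i) => [i1|] ->; case: (unliftP ord0 j) => [j1|] ->;
    rewrite ?q0 ?(eq_sym _ ord0) ?(negPf (neq_lift _ _)) ?eqxx //.
  - case: (unliftP ord0 i1) => [i2|] ->; case: (unliftP ord0 j1) => [j2|] ->;
      rewrite ?q1 ?q2 ?(inj_eq lift_inj) ?(eq_sym _ ord0)
        ?(negPf (neq_lift _ _)) ?eqxx //.
    by rewrite dotC.
  - case: (unliftP ord0 i1) => [i2|] ->; rewrite ?q1 ?q2 dotC ?fE //.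
  - case: (unliftP ord0 j1) => [j2|] ->; rewrite ?q1 ?q2 ?fE //.
have : p *m (Q^T *m Q) = p by rewrite (mulmx1C QQ) mulmx1.
rewrite mulmxA => {1}<-; apply/rowP => l; rewrite !mxE.
have pQ i : (p *m Q^T) 0 i = dot p (q i).
  by rewrite mxE; apply: eq_bigr => j _; rewrite !mxE.
rewrite big_ord_recl big_ord_recl !pQ !mxE q0 q1 big1 ?addr0 // => i _.
by rewrite pQ q2 pE mul0r.
Qed.

(** * The maximum principle and compactness of the sphere *)

Section MaximumPrinciple.
Context {R : realType} {V : topologicalType}.

(* At a maximum [(x0, t0)] of [G - e t] with [t0 > 0], the left difference
   quotients of [G x0] at [t0] are at least [e]. *)
Lemma spatial_maximum_principle (K : set V) (G : V -> R -> R) (t1 M : R) :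
  compact K -> 0 <= t1 ->
  {within K `*` `[0, t1], continuous (fun q => G q.1 q.2)} ->
  (forall x (t : R), K x -> 0 < t <= t1 -> (forall y, K y -> G y t <= G x t) ->
    exists2 d : R, d <= 0 & (s - t)^-1 * (G x s - G x t) @[s --> t^'-] --> d) ->
  (forall x, K x -> G x 0 <= M) ->
  forall x, K x -> G x t1 <= M.
Proof.
move=> cK t10 cG dG GM x Kx; rewrite leNgt; apply/negP => MG.
(* With [t1 + 1] in the denominator, [e * t1] falls short of [G x t1 - M] by exactly [e], so the
   penalized function still exceeds [M] at [(x, t1)], even when [t1 = 0]. *)
pose e := (G x t1 - M) / (t1 + 1).
have t11 : 0 < t1 + 1 by rewrite ltr_wpDl.
have e0 : 0 < e by rewrite divr_gt0 ?subr_gt0.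
have eM : M < G x t1 - e * t1.
  have : e * (t1 + 1) = G x t1 - M by rewrite divfK // gt_eqF.
  by nra.
have cKt : compact (K `*` `[0, t1]).
  by apply: compact_setX => //; exact: segment_compact.
have K0 : K `*` `[0, t1] !=set0.
  by exists (x, 0); split => //=; rewrite in_itv /= lexx.
pose H (q : V * R) : R := G q.1 q.2 - e * q.2.
have cH : {within K `*` `[0, t1], continuous H}.
  have c2 : {within K `*` `[0, t1], continuous (fun q : V * R => e * q.2)}.
    apply: continuous_subspaceT => q'.
    by apply: cvgM; [exact: cvg_cst|exact: cvg_snd].
  by move=> q; exact: cvgB (cG q) (c2 q).
have [[x0 t0]] := compact_EVT_max K0 cKt cH.
rewrite inE /= => -[/= Kx0]; rewrite in_itv /= => /andP[t00 t01] Hmax.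
have {}Hmax y s : K y -> 0 <= s <= t1 -> G y s - e * s <= G x0 t0 - e * t0.
  by move=> Ky st; apply: (Hmax (y, s)); rewrite inE; split => //=; rewrite in_itv.
have t0p : 0 < t0.
  rewrite lt_neqAle t00 andbT; apply/eqP => t0E.
  have := Hmax x t1 Kx; rewrite t10 lexx => /(_ isT).
  rewrite -t0E mulr0 subr0 leNgt => /negP; apply.
  exact: le_lt_trans (GM _ Kx0) eM.
(* At the fixed time [t0] the penalty is constant, so [x0] is also a spatial maximum of [G] and the
   sign hypothesis applies. *)
have [|y Ky|d d0 dE] := dG x0 t0 Kx0; first by rewrite t0p.
  have := Hmax y t0 Ky; rewrite t00 t01 => /(_ isT); lra.
have de : d < e by exact: le_lt_trans d0 e0.
have : \forall s \near t0^'-, False.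
  near=> s.
  have st : s < t0 by near: s; exact: nbhs_left_lt.
  have s0 : 0 < s by near: s; exact: nbhs_left_gt.
  have : (s - t0)^-1 * (G x0 s - G x0 t0) < e by near: s; exact: cvgr_lt dE _ de.
  rewrite ltNge => /negP; apply.
  rewrite mulrC ler_ndivlMr ?subr_lt0 //.
  have := Hmax x0 s Kx0; rewrite (ltW s0) (le_trans (ltW st) t01) => /(_ isT); lra.
by move=> /filter_ex[].
Unshelve. all: by end_near. Qed.

End MaximumPrinciple.

Lemma compact_sphere {R : realType} {m : nat} : compact (@sphere R m).
Proof.
apply: bounded_closed_compact.
  exists 1; split => // r r1 x x1 /=.
  apply: (le_trans _ (ltW r1)); apply: rV_norm_le => // j.
  rewrite -(ler_pXn2r (n := 2)) ?nnegrE // expr1n real_normK ?num_real //.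
  rewrite -[X in _ <= X]x1 /dot (bigD1 j) //= expr2 lerDl.
  by apply: sumr_ge0 => i _; rewrite -expr2 sqr_ge0.
have cd : continuous (fun x : 'rV[R]_m => dot x x).
  move=> x; exact: (@cvg_dot R m _ (nbhs x) _ id id x x (@cvg_id _ _) (@cvg_id _ _)).
rewrite (_ : sphere (m := m) = (fun x => dot x x) @^-1` [set 1]) //.
by apply: preimage_closed => //; exact: closed_eq.
Qed.

Lemma pihalf_segment {R : realType} (r : R) : 0 < r < pi / 2 -> r \in `[0, pi].
Proof.
move=> /andP[r0 rp]; rewrite in_itv /= (ltW r0) /=.
by have := pi_gt0 R; lra.
Qed.

(** * Polar coordinates and the normal at a critical point of the height *)

Section Polar.
Context {R : realType} {m : nat} (p : 'rV[R]_m) (p1 : sphere p).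
Implicit Types (z : 'rV[R]_m) (r : R).

Lemma dot_polar r z : directions p z -> dot p (polar p r z) = cos r.
Proof.
move=> [_ pz]; rewrite /polar dotDr !dotZr p1 mulr1.
by rewrite [dot p z]pz mulr0 addr0.
Qed.

Lemma radius_polar r z : directions p z -> 0 < r < pi / 2 ->
  Defs.radius p (polar p r z) = r.
Proof. by move=> pz rp; rewrite /Defs.radius dot_polar // cosK // pihalf_segment. Qed.

Lemma radial_field_polar r z : directions p z -> 0 < r < pi / 2 ->
  radial_field p (polar p r z) = - sin r *: p + cos r *: z.
Proof.
move=> pz rp; rewrite /radial_field /direction radius_polar //; congr (_ + _ *: _).
by rewrite /polar addrC addKr scalerA mulVf ?scale1r // gt_eqF // sin_gt0_pihalf.
Qed.

(* The tangential part of [p] is [- sin r] times the radial field; a normal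
   parallel to it equals the radial field, because moving inwards along the
   ray stays in the enclosed body. *)
Lemma outward_normal_radial (rho : 'rV[R]_m -> R) z (N : 'rV[R]_m) :
  directions p z -> 0 < rho z < pi / 2 -> sphere N ->
  p = dot p (polar p (rho z) z) *: polar p (rho z) z + dot p N *: N ->
  dot (polar p (rho z) z) N = 0 ->
  (\forall s \near 0^'+, ~ enclosed_body p rho
     (cos s *: polar p (rho z) z + sin s *: N)) ->
  N = radial_field p (polar p (rho z) z) /\ dot p N = - sin (rho z).
Proof.
move=> pz rz N1 pE fN out; set f := polar p (rho z) z in pE fN out *.
have s0 : 0 < sin (rho z) by exact: sin_gt0_pihalf.
have sc := cos2Dsin2 (rho z).
have fE : dot p f = cos (rho z) by exact: dot_polar.
have f1 : dot f f = 1.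
  have [z1 tz] := pz.
  rewrite /f /polar dotDl !dotDr !dotZl !dotZr p1 z1 [dot z p]dotC [dot p z]tz.
  by rewrite -[RHS]sc; ring.
have pj j : p 0 j = cos (rho z) * (cos (rho z) * p 0 j + sin (rho z) * z 0 j) +
    dot p N * N 0 j.
  by rewrite {1}pE fE /f /polar !mxE.
have ssj j : sin (rho z) * sin (rho z) * p 0 j =
    (1 - cos (rho z) * cos (rho z)) * p 0 j.
  by congr (_ * _); rewrite -sc; ring.
(* Pairing the decomposition of [p] with [p] itself gives [1 = cos^2 + (p.N)^2]. *)
have : dot p N ^+ 2 = sin (rho z) ^+ 2.
  have : dot p p = 1 by [].
  rewrite {1}pE dotDl !dotZl [dot f p]dotC [dot N p]dotC fE -!expr2 => E.
  by move: sc E; lra.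
move=> /eqP; rewrite eqf_sqr => /orP[] /eqP pN; last first.
  split=> //; rewrite radial_field_polar //; apply/rowP => j; rewrite !mxE.
  apply: (mulfI (lt0r_neq0 s0)).
  by have := pj j; have := ssj j; rewrite pN; lra.
exfalso.
(* In the remaining case [N] is minus the radial field, so its geodesic runs back along the ray:
   after time [s] it is at radius [rho z - s], inside the body. *)
have NE j : N 0 j = sin (rho z) * p 0 j - cos (rho z) * z 0 j.
  apply: (mulfI (lt0r_neq0 s0)).
  by have := pj j; have := ssj j; rewrite pN; lra.
have : \forall s \near (0 : R)^'+, False.
  near=> s.
  have sp : 0 < s by near: s; exact: nbhs_right_gt.
  have sr : s < rho z by near: s; apply: nbhs_right_lt; case/andP: rz.
  have : ~ enclosed_body p rho (cos s *: f + sin s *: N) by near: s.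
  apply; exists z, (rho z - s); split=> //.
    by rewrite subr_ge0 (ltW sr) lerBlDr lerDl ltW.
  by apply/rowP => j; rewrite /f /polar cosB sinB !mxE NE; ring.
by move=> /filter_ex[].
Unshelve. all: by end_near. Qed.

End Polar.

(** * Evolution of the extrema of the height under the flow *)

Section FlowExtrema.
Context {R : realType} {n k : nat} {p : 'rV[R]_n.+2} {T : \bar R}
  {X nu : 'rV[R]_n.+1 -> R -> 'rV[R]_n.+2} {lam : 'rV[R]_n.+1 -> R -> 'I_n -> R}
  {rho : 'rV[R]_n.+2 -> R -> R}.
Context (kn : (k <= n)%N) (p1 : sphere p)
  (flow : strictly_convex_flow k p T X nu lam rho).

Lemma flow_point x t : sphere x -> times T t ->
  exists2 z, directions p z & X x t = polar p (rho z t) z.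
Proof.
move=> x1 tT; have : (X^~ t @` @sphere R n.+1) (X x t) by exists x.
by rewrite (flow_graph flow tT) => -[z pz <-]; exists z.
Qed.

Lemma height_velocity_at_extremum (eps : R) x t :
  eps != 0 -> sphere x -> times T t ->
  (forall y, sphere y -> eps * dot p (X y t) <= eps * dot p (X x t)) ->
  eps * dot p (flow_speed k p (X x t) (nu x t) (lam x t) *: nu x t) <= 0.
Proof.
move=> eps0 x1 tT xmax.
have [sX X1 _] := flow_immersed flow tT.
have [snu normal] := flow_normal flow tT.
have [fN N1 DN out] := normal x x1.
have [e [te ee ne]] := flow_curvatures flow x1 tT.
have l0 i := flow_strictly_convex flow i x1 tT.
have [z pz XE] := flow_point x1 tT.
have rz := flow_radius flow pz tT.
have pE : p = dot p (X x t) *: X x t + dot p (nu x t) *: nu x t.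
  apply: orthonormal_decomposition ee (X1 _ x1) N1 fN _ _ _ => i.
  - exact: (sdiff_dot_self (f := X^~ t)).
  - exact: DN.
  - exact: (sdiff_critical (f := X^~ t) sX eps0 x1 (te i) xmax).
rewrite XE in pE fN out.
have [NE pN] := outward_normal_radial p1 pz rz N1 pE fN out.
set r := rho z t in rz XE pE fN out NE pN *.
have s0 : 0 < sin r by exact: sin_gt0_pihalf.
have curv i : eps * (sin r * lam x t i) <= eps * cos r.
  apply: (curvature_at_extremum (p := p) sX snu X1 _ x1 (te i) _ _ (ne i) xmax).
  - by move=> y v y1 yv; have [_ _ + _] := normal y y1; apply.
  - by rewrite {1}pE pN (dot_polar p1) // scaleNr XE.
  - by rewrite ee eqxx.
have lamc i : eps * lam x t i <= eps * (cos r / sin r).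
  by rewrite mulrA ler_pdivlMr // mulrAC -mulrA.
have sk : 0 < sigma k (lam x t) by exact: sigma_gt0.
(* Since [nu] is the radial field here, the support function [u] is [sin r]. *)
have speedE : flow_speed k p (X x t) (nu x t) (lam x t) =
    (n - k)%:R / k.+1%:R * cos r -
    sin r * (sigma k.+1 (lam x t) / sigma k (lam x t)).
  by rewrite /flow_speed XE radius_polar // -NE dotZl N1 mulr1.
have key := sigma_succ_le k l0 lamc.
have k0 : 0 < k.+1%:R :> R by rewrite ltr0n.
(* As [dot p nu = - sin r], the claim becomes [eps * speed >= 0]. Both terms of the speed are then
   written with the common factor [sin r / ((k+1) sigma_k)], which reduces it to [key]. *)
rewrite dotZr pN speedE 2!mulrN oppr_le0 mulrA pmulr_lge0 //.
rewrite mulrBr subr_ge0.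
have -> : eps * (sin r * (sigma k.+1 (lam x t) / sigma k (lam x t))) =
    sin r / (k.+1%:R * sigma k (lam x t)) *
    (eps * (k.+1%:R * sigma k.+1 (lam x t))).
  by field; rewrite !gt_eqF.
have -> : eps * ((n - k)%:R / k.+1%:R * cos r) =
    sin r / (k.+1%:R * sigma k (lam x t)) *
    (eps * (cos r / sin r * ((n - k)%:R * sigma k (lam x t)))).
  by field; rewrite !gt_eqF.
by rewrite ler_wpM2l // divr_ge0 ?mulr_ge0 ?ltW.
Qed.

(** Around each point, those at time 0 included, [X] agrees on the slab with an extension continuous
    on an open set. *)
Lemma flow_continuous (c : 'rV[R]_n.+2) (t1 : R) : times T t1 ->
  {within @sphere R n.+1 `*` `[0, t1],
    continuous (fun q : 'rV[R]_n.+1 * R => dot c (X q.1 q.2))}.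
Proof.
move=> [t10 t1T]; apply/subspace_continuousP => -[x t] [/= x1].
rewrite in_itv /= => /andP[t0 tt1].
have tT s : 0 <= s <= t1 -> times T s.
  by move=> /andP[s0 st]; split => //; apply: le_lt_trans t1T; rewrite lee_fin.
have qT : (@sphere R n.+1 `*` times T) (x, t).
  by split=> //; apply: tT; rewrite t0.
have [U [F [oU Uq CF XF]]] := flow_smooth flow qT.
have [cF _] := CF 0%N.
have Fq : dot c (F q) @[q --> (x, t)] --> dot c (F (x, t)).
  by apply: (@cvg_dot _ _ _ (nbhs (x, t))); [exact: cvg_cst|exact: cF].
set A := @sphere R n.+1 `*` `[0, t1].
have Fw : dot c (F q) @[q --> within A (nbhs (x, t))] --> dot c (F (x, t)).
  exact: cvg_within_filter.
suff : dot c (X q.1 q.2) @[q --> within A (nbhs (x, t))] -->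
    dot c (X (x, t).1 (x, t).2) by [].
rewrite XF //; apply: cvg_trans Fw.
have FX : \forall q \near (x, t), A q -> dot c (F q) = dot c (X q.1 q.2).
  apply: filterS (open_nbhs_nbhs (conj oU Uq)) => -[y s] Uys [/= y1].
  by rewrite in_itv /= => st; rewrite (XF (y, s)) //; split => //; exact: tT.
exact: near_eq_cvg FX.
Qed.

(** A positive [eps] controls the maximum of the height, a negative one its minimum; the witness [x]
    is an extremal point at time 0. *)
Lemma extremum_monotone (eps : R) : eps != 0 -> (0 < T)%E ->
  exists2 x, sphere x &
    forall y t, sphere y -> times T t -> eps * dot p (X y t) <= eps * dot p (X x 0).
Proof.
move=> eps0 T0.
have t0 : times T 0 by [].
have cont t1 : times T t1 -> {within @sphere R n.+1 `*` `[0, t1],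
    continuous (fun q : 'rV[R]_n.+1 * R => eps * dot p (X q.1 q.2))}.
  move=> t1T; have -> : (fun q : 'rV[R]_n.+1 * R => eps * dot p (X q.1 q.2)) =
      (fun q => dot (eps *: p) (X q.1 q.2)) by apply/funext => q; rewrite dotZl.
  exact: flow_continuous.
have cK (t1 : R) : compact (@sphere R n.+1 `*` `[0, t1]).
  by apply: compact_setX; [exact: compact_sphere|exact: segment_compact].
(* The degenerate interval [[0, 0]] turns continuity on slabs into existence of an extremum at the
   initial time. *)
have ne0 : @sphere R n.+1 `*` `[(0 : R), 0] !=set0.
  exists (delta_mx 0 0, 0); split => /=; last by rewrite in_itv /= lexx.
  rewrite /sphere /= /dot (bigD1 ord0) //= !mxE eqxx mulr1 big1 ?addr0 // => i i0.
  by rewrite !mxE (negPf i0) andbF mulr0.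
have [[x s]] := compact_EVT_max ne0 (cK 0) (cont 0 t0).
rewrite inE /= => -[/= x1]; rewrite in_itv /= => s0 xmax.
have {s0} sE : s = 0 by apply/eqP; rewrite eq_le andbC.
exists x => // y t y1 tT; have [tge0 tltT] := tT.
apply: (spatial_maximum_principle (G := fun y t => eps * dot p (X y t))
  compact_sphere tge0 (cont t tT)) => // [w s' w1 /andP[s'0 s't] wmax|w w1].
- have s'T : times T s'.
    by split; [exact: ltW|apply: le_lt_trans tltT; rewrite lee_fin].
  exists (eps * dot p (flow_speed k p (X w s') (nu w s') (lam w s') *: nu w s')).
    exact: height_velocity_at_extremum.
  have eq := flow_equation flow w1 s'T.
  have eqp : eps * dot p ((s - s')^-1 *: (X w s - X w s'))
      @[s --> within (times T) s'^'] -->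
      eps * dot p (flow_speed k p (X w s') (nu w s') (lam w s') *: nu w s').
    by apply: cvgM; [exact: cvg_cst|apply: cvg_dot eq; exact: cvg_cst].
  have E : (fun s => (s - s')^-1 *
      (eps * dot p (X w s) - eps * dot p (X w s'))) =
      (fun s => eps * dot p ((s - s')^-1 *: (X w s - X w s'))).
    by apply/funext => a; rewrite dotZr dotBr; ring.
  (* The derivative relative to [times T] yields the left derivative, because points just to the
     left of [s' > 0] belong to [times T]. *)
  rewrite E; apply: cvg_trans eqp.
  apply: cvg_app => P [/= d d0 dP].
  near=> a.
  have as' : a < s' by near: a; exact: nbhs_left_lt.
  apply: dP.
  + rewrite /= gtr0_norm ?subr_gt0 // ltrBlDr -ltrBlDl.
    by near: a; apply: nbhs_left_gt; rewrite ltrBlDr ltrDl.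
  + by rewrite lt_eqF.
  + have a0 : 0 < a by near: a; exact: nbhs_left_gt.
    split; first exact: ltW.
    by apply: lt_trans s'T.2; rewrite lte_fin.
- have := xmax (w, 0); rewrite sE; apply.
  by rewrite inE; split => //=; rewrite in_itv /= lexx.
Unshelve. all: by end_near. Qed.

End FlowExtrema.

(** * From heights back to radii *)

Theorem theorem3p1 (R : realType) (n k : nat) (p : 'rV[R]_n.+2)
    (M0 : set 'rV[R]_n.+2) (rho0 : 'rV[R]_n.+2 -> R) (T : \bar R)
    (X nu : 'rV[R]_n.+1 -> R -> 'rV[R]_n.+2)
    (lam : 'rV[R]_n.+1 -> R -> 'I_n -> R)
    (rho : 'rV[R]_n.+2 -> R -> R) :
  (1 <= n)%N -> (k <= n - 1)%N ->
  sphere p ->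
  M0 `<=` open_hemisphere p ->
  (forall z, directions p z -> 0 < rho0 z < pi / 2) ->
  M0 = radial_graph p rho0 ->
  spherically_convex (enclosed_body p rho0) ->
  sphere_interior (enclosed_body p rho0) p ->
  (0 < T)%E ->
  strictly_convex_flow k p T X nu lam rho ->
  embedded_hypersurface (X^~ 0) ->
  X^~ 0 @` @sphere R n.+1 = M0 ->
  exists a b : R,
    [/\ is_minimum (rho0 @` directions p) a,
        is_maximum (rho0 @` directions p) b
      & forall z t, directions p z -> times T t -> a <= rho z t <= b].
Proof.
move=> n1 kn p1 _ rho0P M0E _ _ T0 flow _ X0.
have {}kn : (k <= n)%N by apply: leq_trans kn (leq_subr _ _).
have t0 : times T 0 by [].
have initial x : sphere x ->
    exists2 z, directions p z & X x 0 = polar p (rho0 z) z.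
  move=> x1; have : M0 (X x 0) by rewrite -X0; exists x.
  by rewrite M0E => -[z pz <-]; exists z.
have initialV z : directions p z ->
    exists2 x, sphere x & X x 0 = polar p (rho0 z) z.
  move=> pz; have : M0 (polar p (rho0 z) z) by rewrite M0E; exists z.
  by rewrite -X0 => -[x x1 <-]; exists x.
have later z t : directions p z -> times T t ->
    exists2 x, sphere x & X x t = polar p (rho z t) z.
  move=> pz tT; have : radial_graph p (rho^~ t) (polar p (rho z t) z) by exists z.
  by rewrite -(flow_graph flow tT) => -[x x1 <-]; exists x.
have cos_le (r s : R) : 0 < r < pi / 2 -> 0 < s < pi / 2 ->
    cos r <= cos s -> s <= r.
  move=> rp sp; rewrite !leNgt; apply: contraNN => rs.
  by rewrite ltr_cos // pihalf_segment.
(* The cosine is decreasing, so the highest initial point [x] has the least radius and the lowest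
   one [y] the greatest; their directions give the witnesses [a] and [b]. *)
have [x x1 xmax] := extremum_monotone kn p1 flow (oner_neq0 R) T0.
have [y y1 ymax] : exists2 y, sphere y & forall y' t, sphere y' -> times T t ->
    -1 * dot p (X y' t) <= -1 * dot p (X y 0).
  by apply: (extremum_monotone kn p1 flow) => //; rewrite oppr_eq0 oner_eq0.
have [za pza XA] := initial x x1; have [zb pzb XB] := initial y y1.
exists (rho0 za), (rho0 zb); split.
- split; first by exists za.
  move=> _ [z pz <-]; have [w w1 WE] := initialV z pz.
  apply: cos_le; try exact: rho0P.
  by have := xmax w 0 w1 t0; rewrite WE XA !mul1r !dot_polar.
- split; first by exists zb.
  move=> _ [z pz <-]; have [w w1 WE] := initialV z pz.
  apply: cos_le; try exact: rho0P.
  by have := ymax w 0 w1 t0; rewrite WE XB !mulN1r lerN2 !dot_polar.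
- move=> z t pz tT; have [w w1 WE] := later z t pz tT.
  have rz := flow_radius flow pz tT.
  apply/andP; split; apply: cos_le => //; try exact: rho0P.
  + by have := xmax w t w1 tT; rewrite WE XA !mul1r !dot_polar.
  + by have := ymax w t w1 tT; rewrite WE XB !mulN1r lerN2 !dot_polar.
Qed.
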